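(* Let $n\ge 3$ and let $\mathcal X$ be an $(n,n-2)$-set of $\mathrm{PG}(n,q)$. Then $$|\mathcal X|\le \left(\frac{n!\,(q^{n+1}-1)(q^n-1)}{(q-1)(q^2-1)}\right)^{\frac{1}{n-1}}+n-2 .$$
   Context: $q$ is a prime power and $\mathrm{PG}(n,q)$ is the $n$-dimensional projective space over $\mathbb F_q$. For integers $r,s$, an $(r,s)$-set of $\mathrm{PG}(n,q)$ is a set $\mathcal X$ of points such that: (i) every $s$-dimensional projective subspace contains at most $r$ points of $\mathcal X$; (ii) $\mathcal X$ spans $\mathrm{PG}(n,q)$; (iii) some $(s+1)$-dimensional projective subspace contains $r+2$ points of $\mathcal X$. *)

(* Defs.v *)
From HB Require Import structures.
From mathcomp Require Import all_boot all_order all_algebra.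
From mathcomp Require Import reals exp.
Set Implicit Arguments. Unset Strict Implicit. Unset Printing Implicit Defensive.
Import Order.TTheory GRing.Theory Num.Theory.
Local Open Scope ring_scope.

(* PG(n,q) is the projective geometry of the row space 'rV[F]_(n.+1) over a
   finite field F with #|F| = q.  A point is a 1-dimensional subspace; we
   represent a set of points by a set of nonzero representative vectors, no
   two of which span the same line. *)
Definition point_set (F : finFieldType) (n : nat) (X : {set 'rV[F]_n.+1}) : Prop :=
  (forall x, x \in X -> x != 0) /\
  (forall x y, x \in X -> y \in X -> (x <= y)%MS -> x = y).

(* A projective subspace of (projective) dimension s is the row space of a
   matrix U of rank s+1; the points of X lying in it: *)
Definition pts_in (F : finFieldType) (n : nat) (X : {set 'rV[F]_n.+1})
  (U : 'M[F]_n.+1) : {set 'rV[F]_n.+1} := [set x in X | (x <= U)%MS].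

Definition rs_set (F : finFieldType) (n r s : nat) (X : {set 'rV[F]_n.+1}) : Prop :=
  [/\ point_set X,
      (forall U : 'M[F]_n.+1, \rank U = s.+1 -> (#|pts_in X U| <= r)%N),
      \rank (\sum_(x in X) <<x>>)%MS = n.+1 &
      exists U : 'M[F]_n.+1, \rank U = s.+2 /\ (r.+2 <= #|pts_in X U|)%N].

(* Main.v *)
Require Import Defs.
From HB Require Import structures.
From mathcomp Require Import all_boot all_order all_algebra.
From mathcomp Require Import reals exp.
From mathcomp Require Import zify ring.
Set Implicit Arguments.
Unset Strict Implicit.
Unset Printing Implicit Defensive.
Import Order.TTheory GRing.Theory Num.Theory.
Local Open Scope ring_scope.

(* Double count the pairs (S, A) where S is an (n-1)-subset of X and A is a
   full-rank 2 x (n+1) matrix whose kernel, a subspace of projective dimension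
   n-2, contains S.  Since S spans at most n-1 dimensions, each S admits at
   least #|GL_2(q)| such A; since that kernel contains at most n points of X,
   each A is counted for at most 'C(n, n-1) = n sets S.  Hence
   'C(|X|, n-1) |GL_2(q)| <= n (q^(n+1) - 1)(q^(n+1) - q), and the bound
   follows from 'C(m, k) k! >= (m - k + 1)^k. *)

Section RowFreeCount.

Variable F : finFieldType.

(* The i-th row may be any vector outside the span of the previous ones. *)
Lemma card_row_free m n : (m <= n)%N ->
  #|[pred A : 'M[F]_(m, n) | row_free A]| =
    (\prod_(0 <= i < m) (#|F| ^ n - #|F| ^ i))%N.
Proof.
pose fr m := [pred A : 'M[F]_(m, n) | row_free A].
elim: m => [_ | m IHm /ltnW-le_mn].
  rewrite (@eq_card1 _ (0 : 'M_(0, n))) ?big_geq //= => A.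
  by rewrite flatmx0 !inE /row_free mxrank.unlock !eqxx.
rewrite big_nat_recr // -{}IHm //= -sum_nat_const /= -sum1_card -add1n.
rewrite (partition_big dsubmx (fr m)) /= => [|A]; last first.
  rewrite !inE /row_free -{1}(vsubmxK A); move: {A}(_ A) (_ A) => Ad Au Afull.
  rewrite eqn_leq rank_leq_row -(leq_add2l (\rank Au)) -mxrank_sum_cap.
  rewrite {1 3}[@mxrank]lock addsmxE (eqnP Afull) -lock -addnA.
  by rewrite leq_add ?rank_leq_row ?leq_addr.
apply: eq_bigr => A rAm; rewrite (reindex (col_mx^~ A)) /=; last first.
  exists usubmx => [v _ | vA]; first by rewrite col_mxKu.
  by case/andP=> _ /eqP <-; rewrite vsubmxK.
transitivity #|~: [set v *m A | v in 'rV_m]|; last first.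
  rewrite cardsCs setCK card_imset ?card_mx ?card_ord ?mul1n //.
  have [B AB1] := row_freeP rAm; apply: can_inj (mulmx^~ B) _ => v.
  by rewrite -mulmxA AB1 mulmx1.
rewrite -sum1_card; apply: eq_bigl => v; rewrite !inE /row_free col_mxKd eqxx.
rewrite andbT eqn_leq rank_leq_row /= -(leq_add2r (\rank (v :&: A)%MS)).
rewrite -addsmxE mxrank_sum_cap (eqnP rAm) addnAC leq_add2r.
rewrite (ltn_leqif (mxrank_leqif_sup _)) ?capmxSl // sub_capmx submx_refl.
by congr (~~ _); apply/submxP/imsetP=> [] [u]; exists u.
Qed.

Lemma card_row_free2 n : (2 <= n)%N ->
  #|[pred A : 'M[F]_(2, n) | row_free A]| =
    ((#|F| ^ n - 1) * (#|F| ^ n - #|F|))%N.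
Proof. by move=> le2n; rewrite card_row_free // big_ltn // big_nat1. Qed.

End RowFreeCount.

Section Annihilators.

Variables (F : finFieldType) (n : nat).
Implicit Types (S X : {set 'rV[F]_n.+1}).

Definition annihilates {k} (A : 'M[F]_(k, n.+1)) S : bool :=
  [forall x in S, x *m A^T == 0].

Lemma rank_span_leq_card S : (\rank (\sum_(x in S) <<x>>)%MS <= #|S|)%N.
Proof.
rewrite -sum1_card; elim/big_rec2: _ => [|x s B _ IH]; first by rewrite mxrank0.
apply: leq_trans (mxrank_adds_leqif _ _).1 _.
by rewrite genmxE leq_add // rank_leq_row.
Qed.

(* The annihilators of S contain the row-free matrices B *m E, for a fixed
   row-free E inside the kernel of the span of S. *)
Lemma card_annihilators_ge k S : (#|S| + k <= n.+1)%N ->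
  (#|[pred B : 'M[F]_k | row_free B]| <=
   #|[pred A : 'M[F]_(k, n.+1) | row_free A && annihilates A S]|)%N.
Proof.
move=> leSk; set span := (\sum_(x in S) <<x>>)%MS; set K := kermx span^T.
have rK : (k <= \rank K)%N.
  rewrite mxrank_ker mxrank_tr.
  by have := rank_span_leq_card S; rewrite -/span; lia.
pose E := (pid_mx k : 'M[F]_(k, \rank K)) *m row_base K.
have freeE : row_free E.
  by rewrite /row_free mxrankMfree ?row_base_free // rank_pid_mx.
have EK : (E <= K)%MS by rewrite -(eq_row_base K) submxMl.
have [E' EE'] := row_freeP freeE.
rewrite -(card_in_imset (f := mulmx^~ E)); last first.
  move=> B1 B2 _ _ /(congr1 (mulmx^~ E')) /=.
  by rewrite -(mulmxA B1) -(mulmxA B2) EE' !mulmx1.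
apply: subset_leq_card; apply/subsetP => _ /imsetP[B freeB ->].
rewrite inE /row_free mxrankMfree // (eqP freeB) eqxx /=.
apply/forallP => x; apply/implyP => xS.
have /submxP[w ->] : (x <= span)%MS by rewrite (sumsmx_sup x) ?genmxE.
move: EK; rewrite sub_kermx => /eqP spanE.
by rewrite trmx_mul !mulmxA -(mulmxA w) -[span](trmxK span) -trmx_mul spanE
  trmx0 mulmx0 mul0mx.
Qed.

(* Every set annihilated by A lies in the subspace kermx A^T of rank n.+1 - k. *)
Lemma card_annihilated_subsets_le (k r s : nat) X (A : 'M[F]_(k, n.+1)) :
  (forall U : 'M[F]_n.+1, \rank U = (n.+1 - k)%N -> (#|pts_in X U| <= r)%N) ->
  row_free A ->
  (#|[set S : {set _} | [&& S \subset X, #|S| == s & annihilates A S]]|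
     <= 'C(r, s))%N.
Proof.
move=> hX freeA; set U := kermx A^T.
have rU : \rank U = (n.+1 - k)%N by rewrite mxrank_ker mxrank_tr (eqP freeA).
apply: (@leq_trans #|[set S : {set _} | S \subset pts_in X U & #|S| == s]|).
  apply: subset_leq_card; apply/subsetP => S; rewrite !inE.
  case/and3P=> SX -> /forallP annS; rewrite andbT; apply/subsetP => x xS.
  by rewrite inE (subsetP SX) // sub_kermx (implyP (annS x)).
by rewrite cards_draws leq_bin2l ?hX.
Qed.

Lemma binomial_card_row_free_leq k r s X :
  (s + k <= n.+1)%N ->
  (forall U : 'M[F]_n.+1, \rank U = (n.+1 - k)%N -> (#|pts_in X U| <= r)%N) ->
  ('C(#|X|, s) * #|[pred B : 'M[F]_k | row_free B]| <=
   'C(r, s) * #|[pred A : 'M[F]_(k, n.+1) | row_free A]|)%N.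
Proof.
move=> lesk hX; set P := [set S : {set _} | S \subset X & #|S| == s].
pose incidences :=
  (\sum_(S in P) \sum_(A : 'M[F]_(k, n.+1) | row_free A) annihilates A S)%N.
have sum_indicator (T : finType) (p a : pred T) :
    (\sum_(i | p i) a i)%N = #|[pred i | p i && a i]|.
  by rewrite -sum1_card big_mkcondr; apply: eq_bigr => i _; case: (a i).
apply: (@leq_trans incidences).
  rewrite -cards_draws -/P -sum_nat_const leq_sum // => S; rewrite inE.
  case/andP=> _ /eqP cardS; rewrite sum_indicator card_annihilators_ge //.
  by rewrite cardS.
rewrite /incidences exchange_big mulnC -sum_nat_const leq_sum // => A freeA.
rewrite sum_indicator; apply: leq_trans (card_annihilated_subsets_le s hX freeA).
by apply/subset_leq_card/subsetP => S; rewrite !inE andbA.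
Qed.

End Annihilators.

Lemma expn_subn_leq_ffact m k : ((m.+1 - k) ^ k <= m ^_ k)%N.
Proof.
elim: k m => [|k IH] [|m] //; first by rewrite subSS sub0n exp0n.
by rewrite ffactnS subSS expnSr mulnC leq_mul ?leq_subr.
Qed.

Lemma le_powRV_of_exprn_le (R : realType) (a c : R) k :
  0 <= a -> (0 < k)%N -> a ^+ k <= c -> a <= powR c (k%:R^-1).
Proof.
move=> a0 k0 akc; have k0R : (k%:R : R) != 0 by rewrite pnatr_eq0 -lt0n.
have -> : a = powR (a ^+ k) (k%:R^-1).
  by rewrite -powR_mulrn // -powRrM mulfV // powRr1.
by apply: ge0_ler_powR; rewrite ?invr_ge0 ?nnegrE ?exprn_ge0 // (le_trans _ akc)
  ?exprn_ge0.
Qed.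

Section GaussianCount.

Variables (R : realType) (p : nat).
Hypothesis p_gt1 : (1 < p)%N.
Local Notation q := (p%:R : R).

(* The common factor q of (q^(n+1) - q) and (q^2 - q) cancels. *)
Lemma gaussian_ratio_ler (b c n : nat) :
  (b * ((p ^ 2 - 1) * (p ^ 2 - p)) <= c * ((p ^ n.+1 - 1) * (p ^ n.+1 - p)))%N ->
  b%:R <= c%:R * (q ^+ n.+1 - 1) * (q ^+ n - 1) / ((q - 1) * (q ^+ 2 - 1)).
Proof.
have q_gt1 : 1 < q by rewrite ltr1n.
have natrB1 j : ((p ^ j - 1)%:R : R) = q ^+ j - 1.
  by rewrite natrB ?natrX // expn_gt0 ltnW.
have natrBp j : ((p ^ j.+1 - p)%:R : R) = q * (q ^+ j - 1).
  rewrite natrB; last by rewrite expnS leq_pmulr // expn_gt0 ltnW.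
  by rewrite natrX exprS mulrBr mulr1.
rewrite -(ler_nat R) !natrM !natrB1 !natrBp => le_bc.
have den_gt0 : 0 < (q - 1) * (q ^+ 2 - 1).
  by rewrite mulr_gt0 // subr_gt0 // exprn_egt1.
rewrite ler_pdivlMr // -(ler_pM2r (lt_trans ltr01 q_gt1)).
have -> : b%:R * ((q - 1) * (q ^+ 2 - 1)) * q =
          b%:R * ((q ^+ 2 - 1) * (q * (q ^+ 1 - 1))) by ring.
apply: le_trans le_bc _; rewrite le_eqVlt; apply/orP; left; apply/eqP; ring.
Qed.

End GaussianCount.

Theorem mainTheorem1 (F : finFieldType) (R : realType) (n : nat)
  (X : {set 'rV[F]_n.+1}) :
  (3 <= n)%N -> rs_set n (n - 2)%N X ->
  let q : R := (#|F|)%:R in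
  (#|X|)%:R <=
    powR ((n`!)%:R * (q ^+ n.+1 - 1) * (q ^+ n - 1) / ((q - 1) * (q ^+ 2 - 1)))
         ((n.-1)%:R^-1) + (n - 2)%N%:R.
Proof.
move=> n3 [_ hX _ _] /=; set m := #|X|.
have [k def_n] : exists k, n = k.+2 by exists (n - 2)%N; lia.
subst n; rewrite !subn2 /= in hX *.
have [small | big] := leqP m k.
  by apply: (@le_trans _ _ k%:R); rewrite ?ler_nat // lerDr powR_ge0.
have hX' (U : 'M[F]_k.+3) : \rank U = (k.+3 - 2)%N -> (#|pts_in X U| <= k.+2)%N.
  by rewrite subn2; apply: hX.
have := binomial_card_row_free_leq (s := k.+1) (k := 2) _ hX'.
rewrite addn2 => /(_ (leqnn _)); rewrite !card_row_free2 // binSn => counting.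
set a := (m - k)%N.
have le_ak : (a ^ k.+1 <= k.+1`! * 'C(m, k.+1))%N.
  by rewrite mulnC bin_ffact /a -subSS expn_subn_leq_ffact.
rewrite -(subnK (ltnW big)) natrD lerD2r; apply: le_powRV_of_exprn_le => //.
rewrite -[_%:R ^+ k.+1]natrX.
apply: gaussian_ratio_ler; first exact: card_finNzRing_gt1.
rewrite factS -mulnA; apply: leq_trans (leq_mul le_ak (leqnn _)) _.
by rewrite -mulnA [leqRHS]mulnCA leq_mul2l counting orbT.
Qed.
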